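(* Let $W(s)=u(\sigma,t)+iv(\sigma,t)$, $s=\sigma+it$, be a meromorphic function of one complex variable in the extended complex plane $\mathbb{C}\cup\{\infty\}$, with $u,v$ its real and imaginary parts, and let $\varphi(\sigma,t)$ be the argument function of $W$ (as defined in the context). Let $s_0=\sigma_0+it_0\in\mathbb{C}\cup\{\infty\}$, and suppose $s_0$ is not a zero or pole of $W(s)$. Then $s_0$ is a zero of the derivative $W'(s)$ if and only if both $$\frac{\partial\varphi}{\partial\sigma}(\sigma,t)\Big|_{s=s_0}=0\quad\text{and}\quad\frac{\partial\varphi}{\partial t}(\sigma,t)\Big|_{s=s_0}=0 .$$
   Context: Write $s=\sigma+it$ for a point of the extended complex plane $\mathbb{C}\cup\{\infty\}$, and $W(s)=u(\sigma,t)+iv(\sigma,t)$ with $u,v$ real-valued. At points that are neither zeros nor poles of $W$ and where $u\neq 0$, the argument function $\varphi(\sigma,t)=\arg\left(\frac{v(\sigma,t)}{u(\sigma,t)}\right)$ of $W$ is given by: (1) $\varphi=\arctan(v/u)$ if $u>0$, $v\ge 0$; (2) $\varphi=\pi-\arctan(v/(-u))$ if $u<0$, $v\ge 0$; (3) $\varphi=\pi+\arctan(v/u)$ if $u<0$, $v<0$; (4) $\varphi=-\arctan((-v)/u)$ if $u>0$, $v<0$. At points that are neither zeros nor poles of $W$ and where $u=0$ (hence $v\neq 0$), the partial derivatives of $\varphi$ are understood as those of the argument function $\varphi_3=\frac{\pi}{2}+\varphi$ of $W_3=iW=-v+iu$, defined by the same four formulas applied to the real part $-v$ and the imaginary part $u$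 of $W_3$; the partial derivatives of $\varphi_3$ and $\varphi$ agree. *)

(* Defs.v *)
From Stdlib Require Import Reals Lra.
From Coquelicot Require Import Coquelicot.
Open Scope R_scope.

(** The extended complex plane. *)
Inductive ext_C : Type :=
  | Fin : C -> ext_C
  | Inf : ext_C.

Definition ext_inv (p : ext_C) : ext_C :=
  match p with
  | Fin z => if Ceq_dec z (RtoC 0) then Inf else Fin (/ z)%C
  | Inf => Fin (RtoC 0)
  end.

(** The value [0] at [Inf] is a dummy: it is only ever seen at poles. *)
Definition fin_part (p : ext_C) : C :=
  match p with
  | Fin z => z
  | Inf => RtoC 0
  end.

Definition complex_derivative (f : C -> C) (z l : C) : Prop :=
  @is_derive C_AbsRing C_NormedModule f z l.

(** Neighbourhoods of infinity in [C]. *)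
Definition at_infinity (P : C -> Prop) : Prop :=
  exists M : R, forall s : C, M < Cmod s -> P s.

Global Instance at_infinity_filter : ProperFilter at_infinity.
Proof.
constructor.
- intros P [M HM]; exists (RtoC (Rabs M + 1)); apply HM.
  rewrite Cmod_R.
  generalize (Rle_abs (Rabs M + 1)) (Rle_abs M); lra.
- constructor.
  + exists 0; auto.
  + intros P Q [M HM] [N HN]; exists (Rmax M N); intros s Hs.
    generalize (Rmax_l M N) (Rmax_r M N); intros H1 H2.
    split; [apply HM | apply HN]; lra.
  + intros P Q HPQ [M HM]; exists M; auto.
Qed.

Definition differentiable_finite_at (f : C -> ext_C) (z : C) : Prop :=
  f z <> Inf /\ exists l : C, complex_derivative (fun w => fin_part (f w)) z l.

(** Holomorphic near [a] if [f a] is finite; otherwise [a] is an isolated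
    singularity at which the modulus tends to infinity. *)
Definition meromorphic_at (f : C -> ext_C) (a : C) : Prop :=
  match f a with
  | Fin _ => locally (T := C_UniformSpace) a (differentiable_finite_at f)
  | Inf =>
      locally' (T := C_UniformSpace) a (differentiable_finite_at f) /\
      filterlim (fun z => Cmod (fin_part (f z)))
        (locally' (T := C_UniformSpace) a) (Rbar_locally p_infty)
  end.

(** At infinity, the local coordinate is [1/s]. *)
Definition meromorphic (W : ext_C -> ext_C) : Prop :=
  (forall a : C, meromorphic_at (fun z => W (Fin z)) a) /\
  meromorphic_at (fun z => W (ext_inv (Fin z))) (RtoC 0).

Definition is_zero (W : ext_C -> ext_C) (p : ext_C) : Prop := W p = Fin (RtoC 0).

Definition is_pole (W : ext_C -> ext_C) (p : ext_C) : Prop := W p = Inf.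

(** The four-case argument of [u + i v]; the value at [u = 0] is a dummy. *)
Definition arg4 (u v : R) : R :=
  if Rlt_dec 0 u then
    if Rle_dec 0 v then atan (v / u) else - atan ((- v) / u)
  else if Rlt_dec u 0 then
    if Rle_dec 0 v then PI - atan (v / (- u)) else PI + atan (v / u)
  else 0.

Definition arg_fun (f : C -> C) (sigma t : R) : R :=
  arg4 (Re (f (sigma, t))) (Im (f (sigma, t))).

(** [is_dsigma_arg f s l]: the derivative in [sigma] of the argument function
    of [f] exists at [s] and equals [l]; where [Re f] vanishes, the argument
    function of [i f] is used instead. *)
Definition is_dsigma_arg (f : C -> C) (s : C) (l : R) : Prop :=
  (Re (f s) <> 0 -> is_derive (fun x : R => arg_fun f x (Im s)) (Re s) l) /\
  (Re (f s) = 0 ->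
     is_derive (fun x : R => arg_fun (fun z => Ci * f z)%C x (Im s)) (Re s) l).

Definition is_dt_arg (f : C -> C) (s : C) (l : R) : Prop :=
  (Re (f s) <> 0 -> is_derive (fun y : R => arg_fun f (Re s) y) (Im s) l) /\
  (Re (f s) = 0 ->
     is_derive (fun y : R => arg_fun (fun z => Ci * f z)%C (Re s) y) (Im s) l).

(** A quantity given on the finite plane by the relation [D s l] ("it is
    defined at [s], with value [l]") is extended to infinity by its limit. *)
Definition value_at {V : UniformSpace} (D : C -> V -> Prop) (p : ext_C) (l : V)
    : Prop :=
  match p with
  | Fin s => D s l
  | Inf => exists g : C -> V,
      at_infinity (fun s => D s (g s)) /\ filterlim g at_infinity (locally l)
  end.

Definition finite_values (W : ext_C -> ext_C) : C -> C :=
  fun s => fin_part (W (Fin s)).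

(** [W'], as a function of [s = sigma + i t] on the extended plane. *)
Definition deriv_value (W : ext_C -> ext_C) : ext_C -> C -> Prop :=
  value_at (V := C_UniformSpace) (complex_derivative (finite_values W)).

Definition dsigma_arg_value (W : ext_C -> ext_C) : ext_C -> R -> Prop :=
  value_at (V := R_UniformSpace) (is_dsigma_arg (finite_values W)).

Definition dt_arg_value (W : ext_C -> ext_C) : ext_C -> R -> Prop :=
  value_at (V := R_UniformSpace) (is_dt_arg (finite_values W)).

(* Main.v *)
Require Import Defs.
From Stdlib Require Import Reals Lra.
From Coquelicot Require Import Coquelicot.
Open Scope R_scope.

(** Off the zeros of the real part, [arg4 u v] is [atan (v / u)] up to a locally
    constant term, so at a finite point with [f <> 0] the two partial derivatives
    of the argument are [Im (f' / f)] and [Im (i f' / f) = Re (f' / f)]; both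
    vanish iff [f' = 0].  At infinity [W] tends to a nonzero finite value, so
    [W' -> 0] iff [W' / W -> 0], i.e. iff the two partial derivatives tend to 0. *)

(** * Complex derivatives and their restriction to lines *)

(** The first-order remainder estimate in terms of [Cmod]: rotating [f] or restricting it to a line
    then only requires estimates of moduli. *)
Lemma complex_derivative_bound (f : C -> C) (s l : C) :
  complex_derivative f s l <->
  forall eps : R, 0 < eps -> exists d : posreal, forall w : C,
    Cmod (w - s) < d -> Cmod (f w - f s - (w - s) * l)%C <= eps * Cmod (w - s).
Proof.
  split.
  - intros [_ H] eps He.
    destruct (H s (fun P HP => HP) (mkposreal eps He)) as [d Hd].
    exists d; intros w Hw; exact (Hd w Hw).
  - intros H; split.
    + exact (is_linear_scal_l (K := C_AbsRing) (V := C_NormedModule) l).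
    + intros x Hx.
      (* The differential is stated at every limit point [x] of the neighbourhood filter of [s]; the
         only such point is [s]. *)
      rewrite <- (is_filter_lim_locally_unique (V := AbsRing_NormedModule C_AbsRing) s x Hx).
      intros eps; destruct (H eps (cond_pos eps)) as [d Hd].
      exists d; intros w Hw; exact (Hd w Hw).
Qed.

Lemma complex_derivative_Ci_mult (f : C -> C) (s l : C) :
  complex_derivative f s l ->
  complex_derivative (fun z => Ci * f z)%C s (Ci * l)%C.
Proof.
  rewrite !complex_derivative_bound; intros H eps He.
  destruct (H eps He) as [d Hd]; exists d; intros w Hw.
  replace (Ci * f w - Ci * f s - (w - s) * (Ci * l))%C
    with (Ci * (f w - f s - (w - s) * l))%C by ring.
  rewrite Cmod_mult, Cmod_Ci, Rmult_1_l; auto.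
Qed.

Lemma Rabs_Re_le (z : C) : Rabs (Re z) <= Cmod z.
Proof. exact (re_le_Cmod z). Qed.

Lemma Rabs_Im_le (z : C) : Rabs (Im z) <= Cmod z.
Proof. eapply Rle_trans; [apply Rmax_r | apply Rmax_Cmod]. Qed.

(** A real-linear [L] bounded by the modulus carries the complex remainder estimate to a real one.
    It is used with [L] equal to [Re] or [Im] and [dir] equal to 1 or [Ci]. *)
Lemma is_derive_along_line (L : C -> R) (f : C -> C) (p : R -> C) (x0 : R) (dir l : C) :
  (forall z w, L (z - w)%C = L z - L w) ->
  (forall (r : R) z, L (RtoC r * z)%C = r * L z) ->
  (forall z, Rabs (L z) <= Cmod z) ->
  (forall x, p x = (p x0 + RtoC (x - x0) * dir)%C) ->
  Cmod dir = 1 ->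
  complex_derivative f (p x0) l ->
  is_derive (fun x => L (f (p x))) x0 (L (dir * l)%C).
Proof.
  intros HLm HLs HLb Hp Hdir Hf.
  apply is_derive_Reals; intros eps He.
  (* Halving [eps] turns the non-strict complex bound into the strict real one. *)
  destruct (proj1 (complex_derivative_bound _ _ _) Hf (eps / 2)) as [d Hd]; [lra|].
  exists d; intros h Hh0 Hh.
  assert (E : (p (x0 + h)%R - p x0 = RtoC h * dir)%C).
  { rewrite Hp; replace (x0 + h - x0) with h by ring; ring. }
  assert (N : Cmod (p (x0 + h)%R - p x0)%C = Rabs h).
  { rewrite E, Cmod_mult, Cmod_R, Hdir; ring. }
  specialize (Hd (p (x0 + h))); rewrite N in Hd; specialize (Hd Hh).
  pose proof (HLb (f (p (x0 + h)%R) - f (p x0) - (p (x0 + h)%R - p x0) * l)%C) as B.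
  rewrite E, !HLm, <- Cmult_assoc, HLs in B; rewrite E, <- Cmult_assoc in Hd.
  assert (Hpos : 0 < Rabs h) by (apply Rabs_pos_lt; exact Hh0).
  replace ((L (f (p (x0 + h))) - L (f (p x0))) / h - L (dir * l)%C)
    with ((L (f (p (x0 + h))) - L (f (p x0)) - h * L (dir * l)%C) / h) by (field; exact Hh0).
  unfold Rdiv; rewrite Rabs_mult, Rabs_inv.
  apply Rmult_lt_reg_r with (Rabs h); [exact Hpos|].
  rewrite Rmult_assoc, Rinv_l, Rmult_1_r by lra.
  assert (0 < eps * Rabs h) by (apply Rmult_lt_0_compat; assumption).
  lra.
Qed.

(** * The four-case argument and its derivative *)

(** Oddness of [atan] merges the two signs of [v], here and for negative [u] below. *)
Lemma arg4_pos (u v : R) : 0 < u -> arg4 u v = atan (v / u).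
Proof.
  intros Hu; unfold arg4; destruct (Rlt_dec 0 u) as [_|]; [|lra].
  destruct (Rle_dec 0 v); [reflexivity|].
  rewrite <- atan_opp; f_equal; field; lra.
Qed.

Lemma arg4_neg (u v : R) : u < 0 -> arg4 u v = PI + atan (v / u).
Proof.
  intros Hu; unfold arg4; destruct (Rlt_dec 0 u) as [|_]; [lra|].
  destruct (Rlt_dec u 0) as [_|]; [|lra].
  destruct (Rle_dec 0 v); [|reflexivity].
  unfold Rminus; rewrite <- atan_opp; do 2 f_equal; field; lra.
Qed.

(** By continuity [u] keeps its sign near [x], so there the argument is [atan (v / u)] plus a
    constant, 0 or [PI]. *)
Lemma is_derive_arg4 (u v : R -> R) (x du dv : R) :
  is_derive u x du -> is_derive v x dv -> u x <> 0 ->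
  is_derive (fun y => arg4 (u y) (v y)) x
    ((u x * dv - v x * du) / (u x ^ 2 + v x ^ 2)).
Proof.
  intros Hu Hv H0.
  assert (Hat : is_derive (fun y => atan (v y / u y)) x
                  ((u x * dv - v x * du) / (u x ^ 2 + v x ^ 2))).
  { evar_last.
    - apply (is_derive_comp atan (fun y => v y / u y)); [apply is_derive_atan|].
      apply is_derive_div; eassumption.
    - unfold scal; simpl; unfold mult; simpl; unfold Rsqr.
      assert (0 < u x ^ 2 + v x ^ 2).
      { generalize (Rsqr_pos_lt _ H0) (Rle_0_sqr (v x)); unfold Rsqr; intros; nra. }
      field; repeat split; try assumption; nra. }
  assert (Hc : continuous u x) by (apply (ex_derive_continuous u); exists du; exact Hu).
  destruct (Rdichotomy _ _ H0) as [Hn|Hp].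
  - apply is_derive_ext_loc with (fun y => PI + atan (v y / u y)).
    + apply (filter_imp (fun y => u y < 0)).
      * intros y Hy; symmetry; apply arg4_neg; exact Hy.
      * apply (Hc (fun z => z < 0)), (open_lt 0); exact Hn.
    + evar_last; [apply (is_derive_plus (fun _ => PI)); [apply is_derive_const | exact Hat]|].
      apply plus_zero_l.
  - apply is_derive_ext_loc with (fun y => atan (v y / u y)); [|exact Hat].
    apply (filter_imp (fun y => 0 < u y)).
    + intros y Hy; symmetry; apply arg4_pos; exact Hy.
    + apply (Hc (fun z => 0 < z)), (open_gt 0); exact Hp.
Qed.

(** * Partial derivatives of the argument and the logarithmic derivative *)

(** With [z] = u + iv and [m] = du + i dv, the right-hand side is the derivative found in
    [is_derive_arg4]. *)
Lemma Im_div (m z : C) :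
  Im (m / z)%C = (Re z * Im m - Im z * Re m) / (Re z ^ 2 + Im z ^ 2).
Proof.
  destruct m as [a b], z as [c d]; unfold Re, Im, Cdiv, Cinv, Cmult, Rdiv; simpl; ring.
Qed.

Lemma Im_Ci_mult (z : C) : Im (Ci * z)%C = Re z.
Proof. destruct z as [a b]; unfold Ci, Re, Im, Cmult; simpl; ring. Qed.

Lemma Re_Ci_mult (z : C) : Re (Ci * z)%C = - Im z.
Proof. destruct z as [a b]; unfold Ci, Re, Im, Cmult; simpl; ring. Qed.

Lemma is_derive_arg_line (f : C -> C) (p : R -> C) (x0 : R) (dir l : C) :
  (forall x, p x = (p x0 + RtoC (x - x0) * dir)%C) ->
  Cmod dir = 1 ->
  complex_derivative f (p x0) l ->
  Re (f (p x0)) <> 0 ->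
  is_derive (fun x => arg4 (Re (f (p x))) (Im (f (p x)))) x0
    (Im (dir * (l / f (p x0)))%C).
Proof.
  intros Hp Hdir Hf H0.
  replace (dir * (l / f (p x0)))%C with ((dir * l) / f (p x0))%C
    by (unfold Cdiv; ring).
  rewrite Im_div.
  apply (is_derive_arg4 (fun x => Re (f (p x))) (fun x => Im (f (p x))));
    [| |exact H0].
  - apply is_derive_along_line with (L := Re); try assumption.
    + intros [] []; reflexivity.
    + intros r []; unfold Re, Cmult; simpl; ring.
    + exact Rabs_Re_le.
  - apply is_derive_along_line with (L := Im); try assumption.
    + intros [] []; reflexivity.
    + intros r []; unfold Im, Cmult; simpl; ring.
    + exact Rabs_Im_le.
Qed.

(** Passing from [f] to [i f] keeps the logarithmic derivative, so both clauses of the partial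
    derivatives yield the same value. At [z] = 0 both sides are 0, since the inverse of 0 evaluates
    to 0. *)
Lemma Ci_mult_div (l z : C) : ((Ci * l) / (Ci * z) = l / z)%C.
Proof.
  destruct (Ceq_dec z 0) as [->|Hz].
  - rewrite Cmult_0_r; unfold Cdiv.
    replace (/ RtoC 0)%C with (RtoC 0); [ring|].
    unfold Cinv, RtoC; simpl; f_equal; unfold Rdiv; ring.
  - field; split; [exact Hz|].
    intros H; apply (f_equal Cmod) in H; rewrite Cmod_Ci, Cmod_0 in H; lra.
Qed.

(** Ensures that where [Re f] vanishes but [f] does not, the derivative formula applies to [i f]. *)
Lemma Re_Ci_mult_neq_0 (z : C) : z <> RtoC 0 -> Re z = 0 -> Re (Ci * z)%C <> 0.
Proof.
  intros Hz H0 H; apply Hz; rewrite Re_Ci_mult in H.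
  destruct z as [a b]; unfold Re, Im in *; simpl in *; unfold RtoC; f_equal; lra.
Qed.

Lemma is_dsigma_arg_log_derivative (f : C -> C) (s l : C) :
  complex_derivative f s l -> f s <> RtoC 0 ->
  is_dsigma_arg f s (Im (l / f s)%C).
Proof.
  intros Hf Hnz; destruct s as [x0 y0].
  assert (Hp : forall x : R, (x, y0) = ((x0, y0) + RtoC (x - x0) * RtoC 1)%C)
    by (intros x; unfold Cplus, Cmult, RtoC; simpl; f_equal; ring).
  split; intros H; rewrite <- (Cmult_1_l (l / _)%C).
  - exact (is_derive_arg_line f (fun x => (x, y0)) x0 _ l Hp Cmod_1 Hf H).
  - rewrite <- Ci_mult_div.
    exact (is_derive_arg_line _ (fun x => (x, y0)) x0 _ _ Hp Cmod_1
             (complex_derivative_Ci_mult _ _ _ Hf) (Re_Ci_mult_neq_0 _ Hnz H)).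
Qed.

Lemma is_dt_arg_log_derivative (f : C -> C) (s l : C) :
  complex_derivative f s l -> f s <> RtoC 0 ->
  is_dt_arg f s (Re (l / f s)%C).
Proof.
  intros Hf Hnz; destruct s as [x0 y0].
  assert (Hp : forall y : R, (x0, y) = ((x0, y0) + RtoC (y - y0) * Ci)%C)
    by (intros x; unfold Cplus, Cmult, RtoC, Ci; simpl; f_equal; ring).
  split; intros H; rewrite <- (Im_Ci_mult (l / _)%C).
  - exact (is_derive_arg_line f (fun y => (x0, y)) y0 _ l Hp Cmod_Ci Hf H).
  - rewrite <- Ci_mult_div.
    exact (is_derive_arg_line _ (fun y => (x0, y)) y0 _ _ Hp Cmod_Ci
             (complex_derivative_Ci_mult _ _ _ Hf) (Re_Ci_mult_neq_0 _ Hnz H)).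
Qed.

(** Whether [Re (f s)] vanishes decides which clause applies, and a real derivative is unique. This
    identifies any given partial derivative with a part of [f' / f]. *)
Lemma is_dsigma_arg_unique (f : C -> C) (s : C) (a b : R) :
  is_dsigma_arg f s a -> is_dsigma_arg f s b -> a = b.
Proof.
  intros [Ha Ha'] [Hb Hb']; destruct (Req_dec (Re (f s)) 0) as [H|H].
  - rewrite <- (is_derive_unique _ _ _ (Ha' H)); exact (is_derive_unique _ _ _ (Hb' H)).
  - rewrite <- (is_derive_unique _ _ _ (Ha H)); exact (is_derive_unique _ _ _ (Hb H)).
Qed.

Lemma is_dt_arg_unique (f : C -> C) (s : C) (a b : R) :
  is_dt_arg f s a -> is_dt_arg f s b -> a = b.
Proof.
  intros [Ha Ha'] [Hb Hb']; destruct (Req_dec (Re (f s)) 0) as [H|H].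
  - rewrite <- (is_derive_unique _ _ _ (Ha' H)); exact (is_derive_unique _ _ _ (Hb' H)).
  - rewrite <- (is_derive_unique _ _ _ (Ha H)); exact (is_derive_unique _ _ _ (Hb H)).
Qed.

(** * Moduli, limits to zero and finite points of meromorphic functions *)

Lemma Cmod_le_Re_Im (z : C) : Cmod z <= Rabs (Re z) + Rabs (Im z).
Proof.
  replace z with (RtoC (Re z) + Ci * RtoC (Im z))%C at 1.
  - eapply Rle_trans; [apply Cmod_triangle|].
    rewrite Cmod_mult, Cmod_Ci, !Cmod_R; lra.
  - destruct z; unfold Re, Im, RtoC, Ci, Cplus, Cmult; simpl; f_equal; ring.
Qed.

Lemma filterlim_C_0 (T : Type) (F : (T -> Prop) -> Prop) (FF : Filter F) (g : T -> C) :
  filterlim g F (locally (T := C_UniformSpace) (RtoC 0)) <->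
  forall eps : R, 0 < eps -> F (fun x => Cmod (g x) < eps).
Proof.
  split.
  - intros H eps He; apply (H (fun z => Cmod z < eps)), locally_C; exists (mkposreal eps He); intros w Hw.
    replace w with (w - RtoC 0)%C by ring; exact Hw.
  - intros H P HP; apply locally_C in HP; destruct HP as [d Hd].
    apply (filter_imp (F := F) (fun x => Cmod (g x) < d)); [|apply H, cond_pos].
    intros x Hx; apply Hd; change (Cmod (g x - RtoC 0)%C < d).
    replace (g x - RtoC 0)%C with (g x) by ring; exact Hx.
Qed.

Lemma filterlim_R_0 (T : Type) (F : (T -> Prop) -> Prop) (FF : Filter F) (g : T -> R) :
  filterlim g F (locally (T := R_UniformSpace) 0) <->
  forall eps : R, 0 < eps -> F (fun x => Rabs (g x) < eps).
Proof.
  rewrite filterlim_locally; split.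
  - intros H eps He; generalize (H (mkposreal eps He)); apply filter_imp; intros x Hx.
    replace (g x) with (g x - 0) by ring; exact Hx.
  - intros H eps; generalize (H eps (cond_pos eps)); apply filter_imp; intros x Hx.
    change (Rabs (g x - 0) < eps); replace (g x - 0) with (g x) by ring; exact Hx.
Qed.

Lemma meromorphic_ex_derivative (W : ext_C -> ext_C) (s : C) :
  meromorphic W -> ~ is_pole W (Fin s) ->
  exists l, complex_derivative (finite_values W) s l.
Proof.
  intros [H _] Hp; specialize (H s); unfold meromorphic_at, is_pole in *.
  destruct (W (Fin s)); [|congruence].
  exact (proj2 (locally_singleton _ _ H)).
Qed.

Lemma finite_values_neq_0 (W : ext_C -> ext_C) (s : C) :
  ~ is_zero W (Fin s) -> ~ is_pole W (Fin s) -> finite_values W s <> RtoC 0.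
Proof.
  unfold is_zero, is_pole, finite_values; destruct (W (Fin s)); simpl; congruence.
Qed.

(** * Behaviour at infinity *)

(** Inversion sends the exterior of the disc of radius [/ d] into the disc of radius [d]; this
    transports facts from the coordinate 1/s back to s. *)
Lemma at_infinity_inv (P : C -> Prop) :
  (exists d : posreal, forall w, Cmod w < d -> P w) ->
  at_infinity (fun s => P (/ s)%C).
Proof.
  intros [d Hd]; exists (/ d); intros s Hs; apply Hd.
  assert (0 < / d) by apply Rinv_0_lt_compat, cond_pos.
  rewrite Cmod_inv.
  - rewrite <- (Rinv_inv d); apply Rinv_lt_contravar; [|exact Hs].
    apply Rmult_lt_0_compat; lra.
  - intros ->; rewrite Cmod_0 in Hs; lra.
Qed.

Lemma at_infinity_neq_0 : at_infinity (fun s => s <> RtoC 0).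
Proof. exists 0; intros s Hs ->; rewrite Cmod_0 in Hs; lra. Qed.

Lemma ext_inv_inv (s : C) : s <> RtoC 0 -> ext_inv (Fin (/ s)%C) = Fin s.
Proof.
  intros Hs; unfold ext_inv; destruct (Ceq_dec (/ s)%C 0) as [E|_].
  - exfalso; apply (f_equal (Cmult s)) in E; rewrite Cinv_r, Cmult_0_r in E by exact Hs.
    apply RtoC_inj in E; lra.
  - f_equal; field; exact Hs.
Qed.

Lemma ext_inv_0 : ext_inv (Fin (RtoC 0)) = Inf.
Proof. unfold ext_inv; destruct (Ceq_dec 0 0); congruence. Qed.

Lemma locally_C_0 (P : C -> Prop) :
  locally (T := C_UniformSpace) (RtoC 0) P ->
  exists d : posreal, forall w, Cmod w < d -> P w.
Proof.
  intros H; apply locally_C in H; destruct H as [d Hd].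
  exists d; intros w Hw; apply Hd; change (Cmod (w - RtoC 0)%C < d).
  replace (w - RtoC 0)%C with w by ring; exact Hw.
Qed.

(** In the coordinate w = 1/s, [W] is finite and differentiable near 0, hence continuous at 0 with
    value [c]. *)
Lemma meromorphic_at_infinity (W : ext_C -> ext_C) (c : C) :
  meromorphic W -> W Inf = Fin c ->
  at_infinity (fun s => ~ is_pole W (Fin s)) /\
  forall eps : R, 0 < eps -> at_infinity (fun s => Cmod (finite_values W s - c)%C < eps).
Proof.
  intros [_ H] HW; unfold meromorphic_at in H; rewrite ext_inv_0, HW in H.
  pose proof at_infinity_neq_0 as Hnz.
  split.
  - generalize (filter_and _ _ (at_infinity_inv _ (locally_C_0 _ H)) Hnz).
    apply filter_imp; intros s [[Hs _] Hs0].
    rewrite ext_inv_inv in Hs by exact Hs0; exact Hs.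
  - intros eps He; destruct (locally_singleton _ _ H) as [_ [l Hl]].
    (* Error constant 1 bounds the distance to [c] by (1 + |l|) |w|, hence the radius
       [eps / (1 + Cmod l)] below. *)
    destruct (proj1 (complex_derivative_bound _ _ _) Hl 1 Rlt_0_1) as [d Hd].
    rewrite ext_inv_0, HW in Hd; simpl in Hd.
    assert (Hl0 := Cmod_ge_0 l).
    assert (He' : 0 < eps / (1 + Cmod l)) by (apply Rdiv_lt_0_compat; lra).
    assert (Hm : 0 < Rmin d (eps / (1 + Cmod l)))
      by (apply Rmin_glb_lt; [apply cond_pos | exact He']).
    assert (B : exists d' : posreal, forall w, Cmod w < d' ->
              Cmod (fin_part (W (ext_inv (Fin w))) - c)%C < eps).
    { exists (mkposreal _ Hm); simpl; intros w Hw.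
      assert (Hw1 := Rlt_le_trans _ _ _ Hw (Rmin_l _ _)).
      assert (Hw2 := Rlt_le_trans _ _ _ Hw (Rmin_r _ _)).
      specialize (Hd w); replace (w - RtoC 0)%C with w in Hd by ring.
      specialize (Hd Hw1).
      change (if Ceq_dec w 0 then Inf else Fin (/ w)%C) with (ext_inv (Fin w)) in Hd.
      set (h := fin_part _) in *.
      replace (h - c)%C with ((h - c - w * l) + w * l)%C by ring.
      eapply Rle_lt_trans; [apply Cmod_triangle|]; rewrite Cmod_mult.
      apply Rle_lt_trans with (Cmod w * (1 + Cmod l)); [lra|].
      apply Rmult_lt_compat_r with (r := 1 + Cmod l) in Hw2; [|lra].
      replace (eps / (1 + Cmod l) * (1 + Cmod l)) with eps in Hw2 by (field; lra).
      exact Hw2. }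
    generalize (filter_and _ _ (at_infinity_inv _ B) Hnz).
    apply filter_imp; intros s [Hs Hs0].
    rewrite ext_inv_inv in Hs by exact Hs0; exact Hs.
Qed.

(** Eventually |f| lies between |c|/2 and 2|c|: the lower bound controls [g / f] by [g], the upper
    one [g] by [g / f]. *)
Lemma log_derivative_limit_at_infinity (f g : C -> C) (c : C) :
  c <> RtoC 0 ->
  (forall eps, 0 < eps -> at_infinity (fun s => Cmod (f s - c)%C < eps)) ->
  filterlim g at_infinity (locally (T := C_UniformSpace) (RtoC 0)) <->
  filterlim (fun s => Im (g s / f s)%C) at_infinity (locally (T := R_UniformSpace) 0) /\
  filterlim (fun s => Re (g s / f s)%C) at_infinity (locally (T := R_UniformSpace) 0).
Proof.
  intros Hc Hf.
  assert (Hc0 : 0 < Cmod c) by (apply Cmod_gt_0; exact Hc).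
  assert (Hb : at_infinity (fun s => Cmod c / 2 < Cmod (f s) < 2 * Cmod c)).
  { generalize (Hf (Cmod c / 2) ltac:(lra)); apply filter_imp; intros s Hs.
    pose proof (Cmod_triangle (f s - c)%C c) as T1.
    replace (f s - c + c)%C with (f s) in T1 by ring.
    pose proof (Cmod_triangle (- (f s - c))%C (f s)) as T2.
    rewrite Cmod_opp in T2.
    replace (- (f s - c) + f s)%C with c in T2 by ring; lra. }
  rewrite (filterlim_C_0 _ _ _), !(filterlim_R_0 _ _ _); split.
  - intros H.
    assert (K : forall eps, 0 < eps -> at_infinity (fun s => Cmod (g s / f s)%C < eps)).
    { intros eps He.
      generalize (filter_and _ _ Hb (H (eps * (Cmod c / 2)) ltac:(nra))).
      apply filter_imp; intros s [[H1 _] H2].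
      assert (Hn : f s <> RtoC 0) by (apply Cmod_gt_0; lra).
      rewrite Cmod_div by exact Hn.
      apply Rmult_lt_reg_r with (Cmod (f s)); [lra|].
      replace (Cmod (g s) / Cmod (f s) * Cmod (f s)) with (Cmod (g s)) by (field; lra).
      nra. }
    split; intros eps He; generalize (K eps He); apply filter_imp; intros s Hs;
      eapply Rle_lt_trans; [apply Rabs_Im_le | exact Hs | apply Rabs_Re_le | exact Hs].
  - intros [HI HR] eps He.
    (* The 4 combines a factor 2 for adding real and imaginary parts with the bound 2|c| on |f|. *)
    assert (He' : 0 < eps / (4 * Cmod c)) by (apply Rdiv_lt_0_compat; lra).
    generalize (filter_and _ _ Hb (filter_and _ _ (HI _ He') (HR _ He'))).
    apply filter_imp; intros s [[H1 H2] [H3 H4]].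
    assert (Hn : f s <> RtoC 0) by (apply Cmod_gt_0; lra).
    pose proof (Cmod_le_Re_Im (g s / f s)%C) as B.
    replace (g s) with (f s * (g s / f s))%C at 1 by (field; exact Hn).
    rewrite Cmod_mult.
    pose proof (Cmod_ge_0 (g s / f s)%C).
    replace eps with (2 * Cmod c * (2 * (eps / (4 * Cmod c)))) by (field; lra).
    apply Rmult_le_0_lt_compat; lra.
Qed.

(** * The equivalence at finite points and at infinity *)

Lemma C_eq_0 (z : C) : Im z = 0 -> Re z = 0 -> z = RtoC 0.
Proof.
  destruct z as [a b]; unfold Re, Im, RtoC; simpl; intros -> ->; reflexivity.
Qed.

Theorem theorem1p13 :
  forall (W : ext_C -> ext_C) (s0 : ext_C),
    meromorphic W ->
    ~ is_zero W s0 ->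
    ~ is_pole W s0 ->
    (deriv_value W s0 (RtoC 0) <->
     dsigma_arg_value W s0 0 /\ dt_arg_value W s0 0).
Proof.
  intros W [s|] HW Hz Hp; unfold deriv_value, dsigma_arg_value, dt_arg_value; simpl.
  - pose proof (finite_values_neq_0 W s Hz Hp) as Hn.
    split.
    + intros Hd.
      replace 0 with (Im (RtoC 0 / finite_values W s)%C) at 1
        by (unfold Cdiv; rewrite Cmult_0_l; reflexivity).
      replace 0 with (Re (RtoC 0 / finite_values W s)%C) at 2
        by (unfold Cdiv; rewrite Cmult_0_l; reflexivity).
      split; [apply is_dsigma_arg_log_derivative | apply is_dt_arg_log_derivative];
        assumption.
    (* Meromorphy supplies a derivative [l]; the partial derivatives then force [l / W] to be 0. *)
    + intros [H1 H2]; destruct (meromorphic_ex_derivative W s HW Hp) as [l Hl].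
      assert (E : (l / finite_values W s)%C = RtoC 0).
      { apply C_eq_0.
        - eapply is_dsigma_arg_unique; [|exact H1].
          apply is_dsigma_arg_log_derivative; assumption.
        - eapply is_dt_arg_unique; [|exact H2].
          apply is_dt_arg_log_derivative; assumption. }
      replace (RtoC 0) with l; [exact Hl|].
      rewrite <- (Cmult_0_r (finite_values W s)), <- E; field; exact Hn.
  - destruct (W Inf) as [c|] eqn:E; [|contradiction].
    assert (Hc : c <> RtoC 0) by (intros ->; exact (Hz E)).
    destruct (meromorphic_at_infinity W c HW E) as [Hfin Hlim].
    set (f := finite_values W) in *.
    assert (Hnz : at_infinity (fun s => f s <> RtoC 0)).
    { generalize (Hlim (Cmod c) (proj1 (Cmod_gt_0 c) Hc)); apply filter_imp.
      intros s Hs H0; rewrite H0 in Hs.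
      replace (RtoC 0 - c)%C with (- c)%C in Hs by ring; rewrite Cmod_opp in Hs; lra. }
    split.
    + intros [g [Hg Hg0]].
      destruct (proj1 (log_derivative_limit_at_infinity f g c Hc Hlim) Hg0) as [HI HR].
      split; [exists (fun s => Im (g s / f s)%C) | exists (fun s => Re (g s / f s)%C)];
        (split; [|assumption]);
        generalize (filter_and _ _ Hnz Hg); apply filter_imp; intros s [Hs Hgs];
        [apply is_dsigma_arg_log_derivative | apply is_dt_arg_log_derivative]; assumption.
    + intros [[g1 [Hg1 L1]] [g2 [Hg2 L2]]].
      (* The candidate for [W'] is [W] times its logarithmic derivative, whose real part is the
         t-derivative [g2] and whose imaginary part is the sigma-derivative [g1]. *)
      set (g := fun s => (f s * (g2 s, g1 s))%C).
      assert (Hq : at_infinity (fun s => (g s / f s)%C = (g2 s, g1 s))).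
      { generalize Hnz; apply filter_imp; intros s Hs; unfold g; field; exact Hs. }
      exists g; split.
      (* Near infinity there are no poles or zeros, so [W'] exists there, and uniqueness of the
         partial derivatives equates it with [g]. *)
      * generalize (filter_and _ _ (filter_and _ _ Hfin Hnz) (filter_and _ _ Hg1 Hg2)).
        apply filter_imp; intros s [[Hs1 Hs2] [H1 H2]].
        destruct (meromorphic_ex_derivative W s HW Hs1) as [l Hl]; fold f in Hl.
        replace (g s) with l; [exact Hl|]; unfold g.
        rewrite <- (is_dsigma_arg_unique _ _ _ _ (is_dsigma_arg_log_derivative f s l Hl Hs2) H1).
        rewrite <- (is_dt_arg_unique _ _ _ _ (is_dt_arg_log_derivative f s l Hl Hs2) H2).
        rewrite <- surjective_pairing; field; exact Hs2.
      * apply (log_derivative_limit_at_infinity f g c Hc Hlim); split.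
        -- apply (filterlim_ext_loc g1); [|exact L1].
           generalize Hq; apply filter_imp; intros s ->; reflexivity.
        -- apply (filterlim_ext_loc g2); [|exact L2].
           generalize Hq; apply filter_imp; intros s ->; reflexivity.
Qed.
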